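(* Let $G$ be a right-ordered group with identity $e$, and let $A$ be a nonempty finite abelian subset of $G$ with $|A|\geq 3$. Let $S=A\cup\{y\}$, where $y\in G\setminus A$, and put $k=|S|$. If $|S^{2}|=3|S|-3$, then either $\langle S\rangle$ is abelian, or there exist elements $x,g\in G$ such that $$S=\{x,xg,\ldots,xg^{k-2},y\}$$ and one of the following holds: (i) $[xg^{i},y]=g^{k-2-2i}$ for every integer $i$ with $0\leq i\leq k-2$; (ii) $[x,y]=e$, $[y,g^{2}]=e$, and $|S|=4$.
   Context: A right-ordered group is a group $G$ with a total order $\leq$ such that $x\leq y$ implies $xz\leq yz$ for all $x,y,z\in G$. A subset $S$ of $G$ is called abelian if the subgroup $\langle S\rangle$ generated by $S$ is abelian. $S^{2}=\{s_{1}s_{2}: s_{1},s_{2}\in S\}$. $[x,y]=x^{-1}y^{-1}xy$. *)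

(* Defs.v *)
From HB Require Import structures.
From mathcomp Require Export all_boot order ssralg ssrint finmap.

Set Implicit Arguments.
Unset Strict Implicit.
Unset Printing Implicit Defensive.

(* Groups need not be finite here: groupType is the structure of arbitrary
   groups of boot/monoid.v, with [~ x, y] = x^-1 * (y^-1 * (x * y)). *)
HB.mixin Record isRightOrdered (d : Order.disp_t) G
    of Group G & Order.Total d G := {
  leMr : forall x y z : G, (x <= y)%O -> (x * z <= y * z :> G)%g%O
}.

#[short(type="rightOrderedGroupType")]
HB.structure Definition RightOrderedGroup (d : Order.disp_t) :=
  { G of isRightOrdered d G & Group G & Order.Total d G }.

Local Open Scope group_scope.
Local Open Scope fset_scope.

(* The subgroup generated by S, as a Prop-valued predicate since it may be
   infinite and membership need not be decidable. *)
Inductive generated (G : groupType) (S : {fset G}) : G -> Prop :=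
  | generated_in x of x \in S : generated S x
  | generated1 : generated S 1
  | generatedM x y of generated S x & generated S y : generated S (x * y)
  | generatedV x of generated S x : generated S x^-1.

Definition abelian_generated (G : groupType) (S : {fset G}) : Prop :=
  forall x y : G, generated S x -> generated S y -> commute x y.

Definition fset_square (G : groupType) (S : {fset G}) : {fset G} :=
  [fset s1 * s2 | s1 in S, s2 in S].

Definition expgz (G : groupType) (g : G) (n : int) : G :=
  match n with
  | Posz m => g ^+ m
  | Negz m => g ^- m.+1
  end.

(* Main.v *)
(** Let n = |A|, let ^y be conjugation by y, and suppose that y does not
    centralise A.  Then y lies outside <A>, and counting A^2, y^2, yA and the
    part of Ay outside yA inside S^2 gives |A^2 u {y^2}| + |N| <= 2n, where N
    is the set of a in A with a^y outside A.  Order A as a_0 < ... < a_(n-1).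
    The increasing chain a_0 a_0 < a_0 a_1 < a_1 a_1 < ... shows
    |A^2| >= 2n-1.
    - If every a_i a_(i+2) equals a_(i+1)^2, then A = {x g^i}.  When N is
      empty, conjugation reverses the progression, which is (i).  Otherwise
      N is a singleton and y^2 is in A^2, so conjugation is an involution on
      <A>.  If it maps two consecutive elements into A then it either fixes A
      or satisfies g^y = g^-1 and y^2 = x x^y, whence (y^-1 x)^2 = 1, and
      torsion-freeness gives y = x.  The remaining possibility is n = 3 with
      N = {xg}, which yields (ii).
    - Otherwise some a_i a_(i+2) is off the chain, so it is the only such
      element, N is empty and y^2 is in A^2.  For n >= 4 the steps
      a_j^-1 a_(j+1) change exactly once, between c and c^2, and the same
      involution argument applies in the coset x<c>; for n = 3 a direct
      inspection suffices. *)
Require Import Defs.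
From mathcomp Require Import zify.

Set Implicit Arguments.
Unset Strict Implicit.
Unset Printing Implicit Defensive.

Import Order.TTheory.

Local Open Scope group_scope.
Local Open Scope fset_scope.

(** * Integer powers and conjugation in an arbitrary group *)

Section IntegerPowers.
Variable G : groupType.
Implicit Types g x y : G.

Lemma commute_mulA3 x g h : commute x g -> x * g * (x * h) = x * x * (g * h).
Proof. by move=> xg; rewrite !mulgA -(mulgA x g) -xg !mulgA. Qed.

Lemma expgzS g (n : int) : expgz g (n + 1)%R = expgz g n * g.
Proof.
case: n => [n|[|n]].
- have -> : (Posz n + 1)%R = Posz n.+1 by lia.
  by rewrite /= expgSr.
- by rewrite /= expg1 mulVg.
have -> : (Negz n.+1 + 1)%R = Negz n by lia.
by rewrite /= -!expVgn (expgSr _ n.+1) mulgVK.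
Qed.

Lemma expgzD g (m n : int) : expgz g (m + n)%R = expgz g m * expgz g n.
Proof.
elim: n => [|n IHn|n IHn].
- by rewrite GRing.addr0 /= mulg1.
- have -> : (m + n.+1%:Z = m + n%:Z + 1)%R by lia.
  rewrite expgzS IHn -mulgA; congr (_ * _); rewrite -expgzS; congr expgz; lia.
apply: (@mulIg _ g); rewrite -expgzS -mulgA -expgzS.
have -> : (m - n.+1%:Z + 1 = m - n%:Z)%R by lia.
by rewrite IHn; congr (_ * expgz _ _); lia.
Qed.

Lemma expgzN g (n : int) : expgz g (- n)%R = (expgz g n)^-1.
Proof. by apply/esym/mulg1_eq; rewrite -expgzD GRing.subrr. Qed.

Lemma conj_expgz g y (n : int) : expgz g n ^ y = expgz (g ^ y) n.
Proof. by case: n => n /=; rewrite ?conjVg conjXg. Qed.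

Lemma commute_expgz x g (n : int) : commute x g -> commute x (expgz g n).
Proof. by case: n => n xg /=; [|apply: commuteV]; apply: commuteX. Qed.

Lemma expgzM g (m n : int) : expgz g (m * n)%R = expgz (expgz g m) n.
Proof.
elim: n => [|n IHn|n IHn]; first by rewrite GRing.mulr0.
- have -> : (m * n.+1%:Z = m * n%:Z + m)%R by lia.
  by rewrite expgzD IHn /= expgSr.
apply: (@mulIg _ (expgz g m)); rewrite -expgzD -expgzS.
have -> : (m * - n.+1%:Z + m = m * - n%:Z)%R by lia.
by rewrite IHn; congr (expgz _ _); lia.
Qed.

Lemma conj_commute x y : commute x y -> x ^ y = x.
Proof. by move/commgP/conjg_fixP. Qed.

Lemma commute_conj x y : x ^ y = x -> commute x y.
Proof. by move/conjg_fixP/commgP. Qed.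

Lemma conj_square x y u v :
  commute x u -> commute x v -> y * y = u * v -> (x ^ y) ^ y = x.
Proof.
by move=> xu xv yy; rewrite -conjgM yy; apply/conj_commute/commuteM.
Qed.

End IntegerPowers.

(** * Monotonicity and torsion-freeness in a right-ordered group *)

Section RightOrdered.
Variables (d : Order.disp_t) (G : rightOrderedGroupType d).
Implicit Types x y z g c : G.

Lemma ltMr x y z : (x < y)%O -> (x * z < y * z)%O.
Proof.
move=> xy; rewrite lt_neqAle leMr ?ltW // andbT.
by apply: contraTneq xy => /mulIg ->; rewrite ltxx.
Qed.

(** Only right multiplication is monotone in general; commutation moves [z] to the right-hand
    side. *)
Lemma ltMl x y z : commute x z -> commute y z -> (x < y)%O -> (z * x < z * y)%O.
Proof. by move=> xz yz xy; rewrite -xz -yz ltMr. Qed.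

(** Squaring is strictly increasing on commuting pairs: [u * u < u * v < v * v]. *)
Lemma square_inj x y : commute x y -> x * x = y * y -> x = y.
Proof.
suff lt_sq (u v : G) : commute u v -> (u < v)%O -> (u * u < v * v)%O.
  move=> xy eq; case: (ltgtP x y) => // h.
    by have := lt_sq _ _ xy h; rewrite eq ltxx.
  by have := lt_sq _ _ (commute_sym xy) h; rewrite eq ltxx.
by move=> uv h; apply: lt_trans (ltMr v h); apply: ltMl => //.
Qed.

Lemma square_eq1 x : x * x = 1 -> x = 1.
Proof. by move=> xx; apply: square_inj; rewrite ?mulg1 //; apply: commute1. Qed.

(* Then y^-1 x is an involution, and a right-ordered group is torsion-free. *)
Lemma square_mul_conj x y : y * y = x * x ^ y -> y = x.
Proof.
move=> yy; apply/esym/(@mulgI _ y^-1); rewrite mulVg.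
apply: square_eq1; apply: (@mulgI _ y); apply: (@mulIg _ y).
by rewrite mulg1 yy conjgE !mulgA mulgV mul1g.
Qed.

Lemma expg_eq1 g n : g ^+ n.+1 = 1 -> g = 1.
Proof.
suff H m (u : G) : (1 < u)%O -> (1 < u ^+ m.+1)%O.
  move=> gn; case: (ltgtP 1 g) => // h; first by have := H n _ h; rewrite gn ltxx.
  have : (1 < g^-1)%O by have := ltMr g^-1 h; rewrite mulgV mul1g.
  by move/(H n); rewrite expVgn gn invg1 ltxx.
move=> u1; elim: m => [|m IH]; first by rewrite expg1.
by apply: (lt_trans u1); rewrite expgSr -{1}[u]mul1g ltMr.
Qed.

Lemma expgz_eq1 g (n : int) : g != 1 -> expgz g n = 1 -> n = 0%R.
Proof.
case: n => [[|n]|n] // /eqP g1; first by move/expg_eq1.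
by move=> /= /eqP; rewrite invg_eq1 => /eqP /expg_eq1.
Qed.

Lemma expgz_inj g : g != 1 -> injective (expgz g).
Proof.
move=> g1 m n mn; suff : (m - n)%R = 0%R by lia.
by apply: (expgz_eq1 g1); rewrite expgzD expgzN mn mulgV.
Qed.

(** * Conjugation by [y] on a coset of a cyclic group *)

(** Both [x] and [c] commute with [y * y], so conjugation by [y] is an involution on them and [z] is
    1 or -1. If [z] is 1, applying it twice to [x] gives [2s = 0]. If [z] is -1, [y] fixes [y * y],
    whence [p = s] and [y * y = x * x ^ y], so [y = x]. *)
Lemma coset_involution x c y (s z p : int) : c != 1 -> commute x c ->
  x ^ y = x * expgz c s -> c ^ y = expgz c z -> y * y = x * x * expgz c p ->
  commute x y /\ commute c y.
Proof.
move=> c1 xc xs cz yy; have cx := commute_sym xc.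
have xcz n : commute x (expgz c n) by apply: commute_expgz.
have cK : (c ^ y) ^ y = c.
  apply: (conj_square _ _ yy); first exact: commuteM.
  exact: commute_expgz.
have xK : (x ^ y) ^ y = x.
  by apply: (conj_square _ _ yy); first exact: commuteM.
have zz : (z * z = 1)%R.
  by apply: (expgz_inj c1); rewrite expgzM -cz -conj_expgz -cz cK /= expg1.
have [z1|z1] : (z = 1 \/ z = -1)%R by nia.
  have cc : c ^ y = c by rewrite cz z1 /= expg1.
  suff s0 : s = 0%R by split; apply: commute_conj; rewrite // xs s0 /= mulg1.
  suff : (s + s = 0)%R by lia.
  apply: (expgz_eq1 c1); apply: (@mulgI _ x).
  by rewrite expgzD mulgA -[in LHS]xs -{1}cc -conj_expgz -conjMg -xs xK mulg1.
suff -> : y = x by split.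
apply: square_mul_conj; rewrite yy xs mulgA; congr (_ * expgz _ _).
suff : (s + s - p = p)%R by lia.
apply: (expgz_inj c1); apply: (@mulgI _ (x * x)); rewrite -yy.
have -> : y * y = (y * y) ^ y by apply/esym/conj_commute; apply/commute_sym/commuteM.
rewrite yy !conjMg conj_expgz cz xs -expgzM commute_mulA3 // -!mulgA -!expgzD.
by congr (_ * (_ * expgz _ _)); lia.
Qed.

(** The quotient of the two consecutive elements is [c], so their images determine [c ^ y], and then
    [x ^ y]. *)
Lemma coset_involution_pair x c y (q q' r r' p : int) : c != 1 -> commute x c ->
  q' = (q + 1)%R ->
  (x * expgz c q) ^ y = x * expgz c r -> (x * expgz c q') ^ y = x * expgz c r' ->
  y * y = x * x * expgz c p ->
  commute x y /\ commute c y.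
Proof.
move=> c1 xc -> bq bq' yy.
have cz : c ^ y = expgz c (r' - r)%R.
  apply: (@mulgI _ ((x * expgz c q) ^ y)).
  rewrite -conjMg -mulgA -expgzS bq' bq -mulgA -expgzD; congr (_ * expgz _ _); lia.
apply: (coset_involution c1 xc _ cz yy (s := (r - (r' - r) * q)%R)).
apply: (@mulIg _ (expgz c q ^ y)); rewrite -conjMg bq conj_expgz cz -expgzM -mulgA -expgzD.
by congr (_ * expgz _ _); lia.
Qed.

(** The swap inverts [h], and [y] fixes [y ^+ 4], so [p = 4 - p]. Fourth powers are used because the
    application has [h = g ^+ 2] and [y * y = x * x * g ^+ p], where [p] may be odd. *)
Lemma swap_contradiction x (h : G) y (p : int) : h != 1 -> commute x h ->
  x ^ y = x * h -> (x * h) ^ y = x -> y ^+ 4 = x ^+ 4 * expgz h p ->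
  p = 2%R.
Proof.
move=> h1 xh xy xhy y4.
have hy : h ^ y = h^-1.
  by apply: (@mulgI _ (x ^ y)); rewrite -conjMg xhy xy mulgK.
suff : (4 - p = p)%R by lia.
apply: (expgz_inj h1); apply: (@mulgI _ (x ^+ 4)); rewrite -y4.
have -> : y ^+ 4 = y ^+ 4 ^ y.
  by apply/esym/conj_commute; apply/commute_sym/commuteX.
rewrite y4 conjMg conj_expgz hy conjXg xy expgMn // -[RHS]mulgA; congr (_ * _).
rewrite expgzD; congr (_ * _).
have -> : h^-1 = expgz h (-1)%R by rewrite expgzN /= expg1.
by rewrite -expgzM; congr (expgz _ _); lia.
Qed.

Lemma cancel_base (u p q r : G) : commute u p ->
  u * (u * r) = u * p * (u * q) -> r = p * q.
Proof. by move=> up; rewrite commute_mulA3 // mulgA => /mulgI. Qed.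

(** * The increasing chain of products of an ordered commuting family *)

Section Chain.
Variables (A : {fset G}) (a : nat -> G) (n : nat).
Hypothesis aA : forall i, (i < n)%N -> a i \in A.
Hypothesis a_comm : forall i j, (i < n)%N -> (j < n)%N -> commute (a i) (a j).
Hypothesis a_lt : forall i j, (i < j)%N -> (j < n)%N -> (a i < a j)%O.

(** Even indices give the squares and odd indices the products of neighbours. The last index is
    [2n-2], hence the length [n.*2.-1]. *)
Let w j := a j./2 * a j.+1./2.
Let step j := (a j)^-1 * a j.+1.

Let w_lt j j' : (j < j')%N -> (j' < n.*2.-1)%N -> (w j < w j')%O.
Proof.
elim: j' => // j' IH; rewrite ltnS leq_eqVlt => jj' j'n.
have ww : (w j' < w j'.+1)%O.
  rewrite /w /= (@a_comm j'.+1./2 j'./2.+1) ?ltMr ?a_lt //; lia.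
case/orP: jj' => [/eqP -> // | jj']; apply: lt_trans ww; apply: IH => //; lia.
Qed.

Let w_le j j' : (w j < w j')%O -> (j < n.*2.-1)%N -> (j < j')%N.
Proof.
move=> ww jn; rewrite ltnNge; apply/negP; rewrite leq_eqVlt => /orP[/eqP e|j'j].
  by rewrite e ltxx in ww.
by have := lt_trans ww (w_lt j'j jn); rewrite ltxx.
Qed.

Let W := [seq w j | j <- iota 0 n.*2.-1].

Lemma chain_card (E : seq G) : uniq E -> {in E, forall e, e \notin W} ->
  {subset E <= fset_square A} -> (size E + n.*2.-1 <= #|` fset_square A|)%N.
Proof.
move=> uE EW EA.
have -> : (size E + n.*2.-1)%N = size (E ++ W) by rewrite size_cat size_map size_iota.
apply: uniq_leq_size => [|x].
  rewrite cat_uniq uE /=; apply/andP; split.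
    by apply/hasPn => x xW; apply: contraL xW => /EW.
  rewrite map_inj_in_uniq ?iota_uniq // => j j'; rewrite !mem_iota /= !add0n.
  move=> jn j'n ww; case: (ltngtP j j') => // /w_lt.
    by move=> /(_ j'n); rewrite ww ltxx.
  by move=> /(_ jn); rewrite ww ltxx.
rewrite mem_cat => /orP[/EA //|/mapP[j]]; rewrite mem_iota => jn ->.
by apply/in_imfset2; apply: aA; lia.
Qed.

Let notin_W j (e : G) : (w j < e)%O -> (e < w j.+2)%O -> (j.+2 < n.*2.-1)%N ->
  e != w j.+1 -> e \notin W.
Proof.
move=> je ej jn ne; apply/negP => /mapP[m]; rewrite mem_iota add0n => /andP[_ mn] em.
rewrite em in je ej ne; have mj := w_le ej mn.
have jm : (j < m)%N by apply: (w_le je); lia.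
have m1 : m = j.+1 by lia.
by rewrite m1 eqxx in ne.
Qed.

Let in_W3 j (e : G) : (w j < e)%O -> (e < w j.+3)%O -> (j.+3 < n.*2.-1)%N ->
  e \in W -> e = w j.+1 \/ e = w j.+2.
Proof.
move=> je ej jn /mapP[m]; rewrite mem_iota add0n => /andP[_ mn] em.
rewrite em in je ej *; have mj := w_le ej mn.
have jm : (j < m)%N by apply: (w_le je); lia.
have [->|->] : m = j.+1 \/ m = j.+2 by lia.
  by left.
by right.
Qed.

Let w_even j : w j.*2 = a j * a j.
Proof. by rewrite /w /= uphalf_double doubleK. Qed.

Let w_odd j : w j.*2.+1 = a j * a j.+1.
Proof. by rewrite /w /= uphalf_double doubleK. Qed.

Let lt_mul i i' j j' : (i <= i')%N -> (j < j')%N -> (i' < n)%N -> (j' < n)%N ->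
  (a i * a j < a i' * a j')%O.
Proof.
move=> ii' jj' i'n j'n; apply: (@lt_le_trans _ _ (a i * a j')).
  by apply: ltMl; rewrite ?a_lt //; apply: a_comm; lia.
by apply: leMr; case: ltngtP ii' => // [h|->//]; rewrite ltW // a_lt.
Qed.

(** For commuting terms this says that [step i.+1] differs from [step i], so the terms from [i] to
    [i.+2] are not in geometric progression. *)
Definition bad i := a i * a i.+2 != a i.+1 * a i.+1.

(** The product lies strictly between [a i * a i.+1] and [a i.+1 * a i.+2], and the only chain
    element there is the square that [bad] excludes. *)
Lemma bad_notin i : (i.+2 < n)%N -> bad i -> a i * a i.+2 \notin W.
Proof.
move=> i_n bi; apply: (@notin_W i.*2.+1).
- by rewrite w_odd lt_mul //; lia.
- by rewrite -doubleS w_odd a_comm 1?[X in (_ < X)%O]a_comm ?lt_mul //; lia.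
- by lia.
by rewrite -doubleS w_even.
Qed.

Lemma card_square_ge : (n.*2.-1 <= #|` fset_square A|)%N.
Proof. exact: (@chain_card [::]). Qed.

Lemma card_square_bad i : (i.+2 < n)%N -> bad i ->
  (n.*2 <= #|` fset_square A|)%N.
Proof.
move=> i_n bi; have -> : n.*2 = (size [:: (a i * a i.+2)%g] + n.*2.-1)%N by rewrite /=; lia.
apply: chain_card => // e; rewrite inE => /eqP ->; first exact: bad_notin.
by apply/in_imfset2; apply: aA; lia.
Qed.

Let aS j : a j.+1 = a j * step j.
Proof. by rewrite /step mulVKg. Qed.

Let aSS j : a j.+2 = a j * (step j * step j.+1).
Proof. by rewrite mulgA -!aS. Qed.

Let aSSS j : a j.+3 = a j * (step j * (step j.+1 * step j.+2)).
Proof. by rewrite mulgA -aS -aSS. Qed.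

Let comm_step j m : (j < n)%N -> (m.+1 < n)%N -> commute (a j) (step m).
Proof.
by move=> jn mn; apply: commuteM; [apply: commuteV|]; apply: a_comm; lia.
Qed.

Let step_neq1 j : (j.+1 < n)%N -> step j != 1.
Proof.
move=> jn; apply/eqP => s1; have := aS j; rewrite s1 mulg1 => e.
by have := a_lt (ltnSn j) jn; rewrite e ltxx.
Qed.

Let step_good j : (j.+2 < n)%N -> ~~ bad j -> step j.+1 = step j.
Proof.
move=> jn /negPn/eqP; rewrite aSS (aS j) => /cancel_base h.
by apply/(@mulgI _ (step j))/h/comm_step; lia.
Qed.

Let step_pow c j : (forall m, (m < j)%N -> step m = c \/ step m = c * c) ->
  exists z : int, a j = a 0 * expgz c z.
Proof.
elim: j => [|j IH] h; first by exists 0%R; rewrite /= mulg1.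
have [|z zP] := IH; first by move=> m mj; apply: h; lia.
have [sc|sc] := h j (ltnSn j).
  by exists (z + 1)%R; rewrite aS sc zP expgzS mulgA.
by exists (z + 1 + 1)%R; rewrite aS sc zP !expgzS !mulgA.
Qed.

Lemma progression_of_good : (1 < n)%N ->
  (forall j, (j.+2 < n)%N -> ~~ bad j) ->
  exists g, [/\ g != 1, commute (a 0) g & forall j, (j < n)%N -> a j = a 0 * g ^+ j].
Proof.
move=> n1 good; exists (step 0); split; [exact: step_neq1|by apply: comm_step; lia|].
have st j : (j.+1 < n)%N -> step j = step 0.
  elim: j => // j IH jn; rewrite step_good ?good ?IH //; lia.
elim=> [|j IH] jn; first by rewrite mulg1.
by rewrite aS IH ?st ?expgSr ?mulgA //; lia.
Qed.

(** * A single break in the progression *)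

Section UniqueBad.
Hypothesis A2 : (#|` fset_square A| <= n.*2)%N.
Variable i : nat.
Hypotheses (i_n : (i.+2 < n)%N) (bi : bad i).

(** A second product off the chain would push the count to [2n+1]. *)
Let in_square e : e \in fset_square A -> e != a i * a i.+2 -> e \in W.
Proof.
move=> eA ne; apply/negPn/negP => eW; move: A2; rewrite leqNgt => /negP; apply.
have := @chain_card [:: e; a i * a i.+2]; rewrite /= inE ne => /(_ isT) h.
have : (2 + n.*2.-1 <= #|` fset_square A|)%N; last by lia.
apply: h => x; rewrite !inE => /orP[/eqP -> //|/eqP ->]; first exact: bad_notin.
by apply/in_imfset2; apply: aA; lia.
Qed.

Let unique_bad j : (j.+2 < n)%N -> j != i -> a j * a j.+2 = a j.+1 * a j.+1.
Proof.
move=> jn ji; apply/eqP/negPn/negP => bj; move/negP: (bad_notin jn bj); apply.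
apply: in_square; first by apply/in_imfset2; apply: aA; lia.
case: (ltngtP j i) ji => // h _; first by rewrite lt_eqF // lt_mul //; lia.
by rewrite gt_eqF // lt_mul //; lia.
Qed.

(** Steps are constant up to [i] and constant after [i]. A product of terms three apart, straddling
    the break, must lie on the chain, and this makes one step the square of the other. The index [j]
    supplies two neighbours differing by exactly [c]. *)
Lemma coset_of_unique_bad : (3 < n)%N ->
  exists c j, [/\ c != 1, commute (a 0) c, (j.+1 < n)%N, a j.+1 = a j * c &
    forall m, (m < n)%N -> exists z : int, a m = a 0 * expgz c z].
Proof.
move=> n3.
have good j : (j.+2 < n)%N -> j != i -> ~~ bad j.
  by move=> jn ji; apply/negPn/eqP/unique_bad.
have below j : (j <= i)%N -> step j = step i.
  move=> ji; have [m ->] : exists m, j = (i - m)%N by exists (i - j)%N; lia.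
  elim: m => [|m IH]; first by rewrite subn0.
  rewrite -IH; case: (ltnP m i) => mi; last by congr step; lia.
  have -> : (i - m)%N = (i - m.+1).+1 by lia.
  by rewrite step_good ?good //; lia.
have above j : (i < j)%N -> (j.+1 < n)%N -> step j = step i.+1.
  elim: j => // j IH; rewrite ltnS leq_eqVlt => /orP[/eqP -> //|ij] jn.
  by rewrite step_good ?good ?IH //; lia.
have neq : step i.+1 <> step i.
  have ci : commute (a i) (step i) by apply: comm_step; lia.
  move=> e; move/eqP: bi; apply.
  by rewrite aSS e (aS i) (commute_mulA3 _ ci) mulgA.
have fin c : step i = c * c /\ step i.+1 = c \/ step i = c /\ step i.+1 = c * c ->
    forall m, (m < n)%N -> exists z : int, a m = a 0 * expgz c z.
  move=> cP m mn; apply: step_pow => l lm; case: (leqP l i) => li.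
    by rewrite below //; case: cP => -[-> _]; [right|left].
  by rewrite above //; [case: cP => -[_ ->]; [left|right]|lia].
have squareP (l m : nat) : (l < n)%N -> (m < n)%N -> a l * a m \in fset_square A.
  by move=> pn qn; apply/in_imfset2; apply: aA.
(* With four terms available, the bad triple extends by one index: to the right when [i = 0], to the
   left otherwise. *)
case: (posnP i) => [i0|i_gt0].
  exists (step i.+1), i.+1; split; rewrite -?aS //; try lia.
  - by apply: step_neq1; lia.
  - by apply: comm_step; lia.
  apply: fin; left; split=> //.
  have e2 : step i.+2 = step i.+1 by rewrite above //; lia.
  have ci : commute (a i) (step i) by apply: comm_step; lia.
  have lo : (w i.*2.+1 < a i * a i.+3)%O by rewrite w_odd lt_mul //; lia.
  have hi : (a i * a i.+3 < w i.*2.+4)%O.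
    have -> : i.*2.+4 = i.+2.*2 by lia.
    by rewrite w_even -(@unique_bad i.+1) ?ltMr ?a_lt //; lia.
  have eW : a i * a i.+3 \in W.
    by apply: in_square; rewrite ?squareP ?gt_eqF ?lt_mul //; lia.
  (* Only two chain elements remain: the first gives the square relation, the second would make the
     two steps equal. *)
  have [||] := in_W3 lo hi _ eW; first by lia.
    by rewrite -doubleS w_even aSSS e2 (aS i) => /(cancel_base ci) /mulgI.
  rewrite -doubleS w_odd aSSS e2 aSS (aS i) => /(cancel_base ci).
  by move/mulgI/mulIg; case/neq.
exists (step i), i; split; rewrite -?aS //; try lia.
- by apply: step_neq1; lia.
- by apply: comm_step; lia.
apply: fin; right; split=> //.
have [h ih] : exists h : nat, i = h.+1 by exists i.-1; lia.
have e0 : step h = step h.+1 by rewrite -ih below //; lia.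
have ch : commute (a h) (step h.+1) by rewrite -e0; apply: comm_step; lia.
rewrite ih in neq *.
have lo : (w h.+1.*2 < a h * a h.+3)%O.
  by rewrite w_even -(@unique_bad h) ?lt_mul // ?ih //; lia.
have hi : (a h * a h.+3 < w h.+1.*2.+3)%O.
  have -> : h.+1.*2.+3 = h.+2.*2.+1 by lia.
  by rewrite w_odd ltMr // a_lt //; lia.
have eW : a h * a h.+3 \in W.
  apply: in_square; first by rewrite squareP //; lia.
  by rewrite ih lt_eqF // ltMr // a_lt //; lia.
have [||] := in_W3 lo hi _ eW; first by lia.
  rewrite w_odd aSSS aSS (aS h) e0 => /(cancel_base ch).
  by move/mulgI/mulgI; case/neq.
rewrite -doubleS w_even aSSS aSS e0 => /(cancel_base (commuteM ch ch)).
by rewrite [LHS]mulgA => /mulgI.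
Qed.

End UniqueBad.
End Chain.

(** * Counting the square of the enlarged set *)

(** The blocks are disjoint: products from [A] commute with [x], while [y * a] and [a * y] do not;
    [y * y] is in neither translate because [y] is outside [A]; and [a * y] lies in [yA] exactly
    when [a ^ y] lies in [A]. *)
Lemma card_square_setU1 (A : {fset G}) y x :
  {in A &, forall a b, commute a b} -> x \in A -> ~ commute x y ->
  (#|` fset_square A `|` [fset (y * y)%g]| + #|` A|
     + #|` [fset a in A | (a ^ y)%g \notin A]|
   <= #|` fset_square (A `|` [fset y])|)%N.
Proof.
move=> Ac xA xy; set N := [fset a in A | _].
have yA : y \notin A by apply/negP => yA; apply: xy; apply: Ac.
have AS a : a \in A -> a \in A `|` [fset y] by move=> aA; rewrite in_fsetE aA.
have yS : y \in A `|` [fset y] by rewrite !in_fsetE eqxx orbT.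
have sqC z : z \in fset_square A -> commute x z.
  by case/imfset2P => b bA [c cA ->]; apply: commuteM; apply: Ac.
pose B := [fset (y * a)%g | a in A]; pose C := [fset (a * y)%g | a in N].
have cB : #|` B| = #|` A| by apply: card_imfset; apply: mulgI.
have cC : #|` C| = #|` N| by apply: card_imfset; apply: mulIg.
set D := _ `|` [fset y * y].
have DB : D `&` B = fset0.
  apply/fsetP => z; rewrite !inE; apply/negP => /andP[zD /imfsetP[/= a aA za]].
  case/orP: zD => [/sqC|/eqP].
    rewrite za => h; apply: xy; rewrite -(mulgK a y).
    by apply: commuteM => //; apply/commuteV/Ac.
  by rewrite za => /mulgI ay; rewrite -ay aA in yA.
have DBC : (D `|` B) `&` C = fset0.
  apply/fsetP => z; rewrite !inE; apply/negP => /andP[zD /imfsetP[/= a]].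
  rewrite !inE /= => /andP[aA aN] za; case/orP: zD => [/orP[/sqC|/eqP]|].
  - rewrite za => h; apply: xy; rewrite -(mulKg a y).
    by apply: commuteM => //; apply/commuteV/Ac.
  - by rewrite za => /mulIg ay; rewrite -ay aA in yA.
  case/imfsetP => /= b bA zb; move/negP: aN; apply.
  by rewrite conjgE -za zb mulKg.
have -> : (#|` D| + #|` A| + #|` N|)%N = #|` D `|` B `|` C|.
  by rewrite cardfsU DBC cardfsU DB cardfs0 !subn0 cB cC.
apply/fsubset_leq_card/fsubsetP => z; rewrite !inE => /orP[/orP[/orP[]|]|].
- by case/imfset2P => b bA [c cA ->]; apply/in_imfset2; apply: AS.
- by move/eqP ->; apply/in_imfset2.
- by case/imfsetP => /= a aA ->; apply/in_imfset2 => //; apply: AS.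
by case/imfsetP => /= a; rewrite !inE => /andP[aA _] ->; apply/in_imfset2 => //; apply: AS.
Qed.

(** * Conjugation on three commuting elements *)

(** As [y] fixes [y * y], only [u * v] and [w * w] survive as its value. They force [y = u] and
    [y = w], and either way [y] would commute with [u]. *)
Lemma no_transposition u v w p q y :
  commute u v -> commute u w -> commute v w -> u != v ->
  u ^ y = v -> v ^ y = u -> w ^ y = w ->
  p \in [:: u; v; w] -> q \in [:: u; v; w] -> y * y <> p * q.
Proof.
move=> uv uw vw /eqP nuv uy vy wy pP qP yy.
have nuy : ~ commute u y by move/conj_commute; rewrite uy => /esym.
have fix2 : (p * q) ^ y = p * q by rewrite -yy conjMg (conj_commute (commute_refl y)).
have y_u : y * y = u * v -> False.
  by rewrite -{1}uy => /square_mul_conj yu; apply: nuy; rewrite yu.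
move: pP qP; rewrite !inE => /or3P[]/eqP pe /or3P[]/eqP qe; move: fix2 yy;
  rewrite {p}pe {q}qe conjMg ?uy ?vy ?wy.
- by move/(square_inj (commute_sym uv))/esym.
- by move=> _ /y_u.
- by move/mulIg/esym.
- by move=> _; rewrite -uv => /y_u.
- by move/(square_inj uv).
- by move/mulIg.
- by move/mulgI/esym.
- by move/mulgI.
move=> _ /square_inj yw; apply: nuy; rewrite yw //.
exact/commute_sym/commute_conj.
Qed.

Lemma involution_fixes3 a b c p q y :
  commute a b -> commute a c -> commute b c -> a != b -> a != c -> b != c ->
  {in [:: a; b; c], forall x, x ^ y \in [:: a; b; c]} ->
  p \in [:: a; b; c] -> q \in [:: a; b; c] -> y * y = p * q ->
  {in [:: a; b; c], forall x, x ^ y = x}.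
Proof.
move=> ab ac bc nab nac nbc yP pP qP yy.
have comm : {in [:: a; b; c] &, forall u v, commute u v}.
  by move=> u v; rewrite !inE => /or3P[]/eqP -> /or3P[]/eqP ->.
have K x : x \in [:: a; b; c] -> (x ^ y) ^ y = x.
  by move=> xP; apply: conj_square yy; apply: comm.
have [aP bP cP] : [/\ a \in [:: a; b; c], b \in [:: a; b; c] & c \in [:: a; b; c]].
  by rewrite !inE !eqxx !orbT.
have no_swap u v w : u != v -> u ^ y = v -> w ^ y = w ->
    [:: a; b; c] =i [:: u; v; w] -> False.
  move=> uv uy wy e.
  have [uP vP wP] : [/\ u \in [:: a; b; c], v \in [:: a; b; c] & w \in [:: a; b; c]].
    by rewrite !e !inE !eqxx !orbT.
  have vy : v ^ y = u by rewrite -uy K.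
  by apply: (@no_transposition u v w p q y) => //; rewrite -?e //; apply: comm.
have eq_acb : [:: a; b; c] =i [:: a; c; b] by move=> x; rewrite !inE; do !case: eqP.
have eq_bca : [:: a; b; c] =i [:: b; c; a] by move=> x; rewrite !inE; do !case: eqP.
suff [fa fb fc] : [/\ a ^ y = a, b ^ y = b & c ^ y = c].
  by move=> x; rewrite !inE => /or3P[]/eqP ->.
have := K a aP; have := K b bP; have := K c cP.
have := yP a aP; have := yP b bP; have := yP c cP; rewrite !inE.
(* Of the 27 self-maps of the triple, being an involution leaves the identity and three
   transpositions. *)
move=> /or3P[]/eqP fc /or3P[]/eqP fb /or3P[]/eqP fa; rewrite ?(fa, fb, fc) => kc kb ka;
  rewrite ?kc ?kb ?ka ?eqxx // in nab nac nbc.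
- by case: (no_swap a c b).
- by case: (no_swap b c a).
by case: (no_swap a b c).
Qed.

(** * Conjugation on a geometric progression *)

(** Conjugation acts on exponents by [i -> r + z * i]. The images of both end exponents lie between
    0 and [n-1], and [z] is nonzero, so the map is the identity or the reversal. *)
Lemma progression_normal_form x g y n :
  (2 < n)%N -> commute x g -> g != 1 ->
  (forall j, (j < n)%N -> exists2 r, (r < n)%N & (x * g ^+ j) ^ y = x * g ^+ r) ->
  commute x y /\ commute g y \/
  forall i, (i < n)%N -> [~ x * g ^+ i, y] = expgz g (n%:Z - 1 - 2 * i%:Z)%R.
Proof.
move=> n2 xg g1 gy.
have [r rn x_r] := gy 0%N ltac:(lia); rewrite expg0 mulg1 in x_r.
have [r1 r1n x_r1] := gy 1%N ltac:(lia); rewrite expg1 in x_r1.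
have [e en x_e] := gy n.-1 ltac:(lia).
pose z : int := (r1%:Z - r%:Z)%R.
have gz : g ^ y = expgz g z.
  apply: (@mulgI _ (x ^ y)); rewrite -conjMg x_r1 x_r -mulgA; congr (_ * _).
  rewrite -[g ^+ r]/(expgz g r) -expgzD -[LHS]/(expgz g r1).
  by congr (expgz _ _); lia.
have conj_pow (i : nat) : (x * g ^+ i) ^ y = x * expgz g (r%:Z + z * i%:Z)%R.
  by rewrite conjMg conjXg x_r gz -[_ ^+ i]/(expgz (expgz g z) i) -expgzM expgzD mulgA.
have ze : (r%:Z + z * n.-1%:Z = e%:Z)%R.
  by apply: (expgz_inj g1); apply: (@mulgI _ x); rewrite -conj_pow x_e.
have z0 : z <> 0%R.
  move=> z0; move/eqP: gz; rewrite z0 /= conjg_eq1; exact/negP.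
have [[z1 r0]|[z1 rn1]] : z = 1%R /\ r = 0%N \/ z = (-1)%R /\ r = n.-1.
- have [h|h] : z = 1%R \/ z = (-1)%R by nia.
    by left; split => //; rewrite h in ze; lia.
  by right; split => //; rewrite h in ze; lia.
- by left; split; apply: commute_conj; rewrite ?x_r ?r0 ?gz ?z1 /= ?mulg1 ?expg1.
right=> i i_n; apply: (@mulgI _ (x * g ^+ i)).
rewrite commgEl mulVKg conj_pow -mulgA; congr (_ * _).
by rewrite -[g ^+ i]/(expgz g i) -expgzD; congr (expgz _ _); rewrite z1; lia.
Qed.

Lemma nearly_preserved_progression x g y n p m :
  (2 < n)%N -> commute x g -> g != 1 -> y * y = x * x * g ^+ p -> (m < n)%N ->
  (forall j, (j < n)%N -> j != m ->
     exists2 r, (r < n)%N & (x * g ^+ j) ^ y = x * g ^+ r) ->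
  (forall r, (r < n)%N -> (x * g ^+ m) ^ y != x * g ^+ r) ->
  commute x y /\ commute g y \/ [/\ n = 3, commute x y & commute y (g ^+ 2)].
Proof.
move=> n2 xg g1 yy mn gy gm.
have [[j [jn jm j1m]]|[n3 m1]] :
    (exists j : nat, [/\ (j.+1 < n)%N, j != m & j.+1 != m]) \/ n = 3 /\ m = 1%N.
- case: (ltnP n 4) => n4.
    case: (eqVneq m 1%N) => m1; first by right; lia.
    by left; case: (eqVneq m 0) => m0; [exists 1%N|exists 0]; split; lia.
  by left; case: (ltnP m 2) => m2; [exists 2|exists 0]; split; lia.
- have [r _ jr] := gy j ltac:(lia) jm; have [r' _ jr'] := gy j.+1 jn j1m.
  left; apply: (@coset_involution_pair x g y j j.+1 r r' p) => //; lia.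
right; move: gy gm mn; rewrite {}n3 {}m1 => gy gm _.
have yyx : commute x (y * y) by rewrite yy; apply: commuteM; [apply: commuteM|apply: commuteX].
have yyg : commute g (y * y).
  by rewrite yy; apply: commuteM; [apply: commuteM; apply: commute_sym|apply: commuteX].
have K j : ((x * g ^+ j) ^ y) ^ y = x * g ^+ j.
  rewrite -conjgM; apply: conj_commute; apply/commute_sym/commuteM; apply/commute_sym => //.
  by apply/commute_sym/commuteX/commute_sym.
(* Conjugating twice is the identity here, so an element sent to [x * g] would be the image of
   [x * g], which leaves the progression. *)
have not1 j : (j < 3)%N -> (x * g ^+ j) ^ y <> x * g ^+ 1.
  by move=> j3 e; move: (gm j j3); rewrite -e K eqxx.
have ge j : j != 1%N -> (j < 3)%N -> (x * g ^+ j) ^ y = x \/ (x * g ^+ j) ^ y = x * g ^+ 2.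
  move=> j1 j3; have [[|[|[|r]]] // _ e] := gy j j3 j1.
  - by left; rewrite e mulg1.
  - by have := not1 j j3.
  - by right.
have [x0|x0] := ge 0 isT isT; rewrite expg0 mulg1 in x0.
  have [x2|x2] := ge 2 isT isT.
    have : x * g ^+ 2 = x by rewrite -(K 2) x2 x0.
    by rewrite -[RHS]mulg1 => /mulgI /expg_eq1 g0; rewrite g0 eqxx in g1.
  split=> //; first exact: commute_conj.
  apply/commute_sym/commute_conj/(@mulgI _ (x ^ y)).
  by rewrite -conjMg x2 x0.
(* The remaining case swaps [x] and [x * g ^+ 2]. It forces [p = 2], hence [y * y = x * x ^ y] and
   [y = x], for which the claimed commutations are immediate. *)
have x2 : (x * g ^+ 2) ^ y = x by rewrite -x0 -[RHS]mulg1 -(K 0) expg0 mulg1.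
have g2 : g ^+ 2 != 1 by apply: contraNneq g1 => /expg_eq1 ->.
have p2 : (p%:Z = 2)%R.
  apply: (swap_contradiction g2 _ x0 x2); first exact: commuteX.
  rewrite -[expgz _ _]/(g ^+ 2 ^+ p) -expgnA mulnC expgnA.
  rewrite (_ : y ^+ 4 = (y * y) ^+ 2); last by rewrite -expg2 -expgnA.
  rewrite yy expgMn -?expg2 -?expgnA //.
  by apply: commuteX; apply/commute_sym/commuteX/commute_sym.
have yx : y = x.
  by apply: square_mul_conj; rewrite yy x0 mulgA; congr (_ * g ^+ _); lia.
by split=> //; rewrite yx //; apply: commuteX.
Qed.

(** * Assembling the structure of [A] and the action of [y] *)

Lemma abelian_set_normal_form (A : {fset G}) y x0 :
  {in A &, forall a b, commute a b} -> (2 < #|` A|)%N ->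
  x0 \in A -> ~ commute x0 y ->
  (#|` fset_square A `|` [fset (y * y)%g]|
     + #|` [fset a in A | (a ^ y)%g \notin A]| <= #|` A|.*2)%N ->
  exists x g, A = [fset x * g ^+ i | i in iota 0 #|` A|] /\
    ((forall i, (i < #|` A|)%N ->
       [~ x * g ^+ i, y] = expgz g (#|` A|%:Z - 1 - 2 * i%:Z)%R) \/
     [/\ #|` A| = 3, commute x y & commute y (g ^+ 2)]).
Proof.
set n := #|` A|; set N := [fset a in A | _] => Ac n2 x0A x0y card_le.
(* The default value 1 is harmless: every fact about [a] is restricted to indices below [n]. *)
pose s := sort <=%O (enum_fset A); pose a i := nth 1 s i.
have sn : size s = n by rewrite size_sort.
have aA i : (i < n)%N -> a i \in A by move=> i_n; rewrite -(mem_sort <=%O) mem_nth ?sn.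
have aP b : b \in A -> exists2 i, (i < n)%N & b = a i.
  rewrite -(mem_sort <=%O) => bs; exists (index b s); last by rewrite /a nth_index.
  by rewrite -sn index_mem.
have a_comm i j : (i < n)%N -> (j < n)%N -> commute (a i) (a j).
  by move=> i_n j_n; apply: Ac; apply: aA.
have a_lt i j : (i < j)%N -> (j < n)%N -> (a i < a j)%O.
  have st : sorted <%O s by rewrite sort_lt_sorted fset_uniq.
  by move=> ij jn; apply: (sorted_ltn_nth lt_trans) => //; rewrite inE sn //; lia.
have noncomm : ~ (forall i, (i < n)%N -> commute (a i) y).
  by move=> h; have [i i_n e] := aP _ x0A; apply: x0y; rewrite e; apply: h.
have inN b : b \in A -> (b \in N) = (b ^ y \notin A) by move=> bA; rewrite !inE bA.
have A2_ge := card_square_ge aA a_comm a_lt.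
have squareP : y * y \in fset_square A ->
    exists i j, [/\ (i < n)%N, (j < n)%N & y * y = a i * a j].
  case/imfset2P => b /aP[i i_n ->] [c /aP[j jn ->] e]; by exists i, j.
have card_sq : y * y \notin fset_square A ->
    #|` fset_square A `|` [fset y * y]| = #|` fset_square A|.+1.
  by move=> h; rewrite fsetUC cardfsU1 h.
have card_sq_ge : (#|` fset_square A| <= #|` fset_square A `|` [fset (y * y)%g]|)%N.
  by apply/fsubset_leq_card/fsubsetUl.
have [/hasP[i]|good] := boolP (has (bad a) (iota 0 n.-2)).
  rewrite mem_iota add0n => i_n bi; have {}i_n : (i.+2 < n)%N by lia.
  have A2_ge' := card_square_bad aA a_comm a_lt i_n bi.
  (* A bad index already uses up the bound [2n], leaving no room for [N] or for [y * y] outside the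
     square of [A]. *)
  have N0 : N = fset0 by apply/cardfs0_eq; lia.
  have yyA : y * y \in fset_square A by apply/negPn/negP => /card_sq; lia.
  have [k [l [kn ln yy]]] := squareP yyA.
  have yA j : (j < n)%N -> a j ^ y \in A.
    by move=> jn; apply/negPn; rewrite -inN ?aA // N0.
  exfalso; apply: noncomm; case: (ltnP 3 n) => n3.
    have [|c [j [c1 xc jn aj aC]]] := coset_of_unique_bad aA a_comm a_lt _ i_n bi n3; first by lia.
    have [z ajz] := aC j ltac:(lia).
    have ajz1 : a j.+1 = a 0 * expgz c (z + 1)%R by rewrite aj ajz expgzS mulgA.
    have [m mn yj] := aP _ (yA j ltac:(lia)); have [r mr] := aC m mn.
    have [m' mn' yj'] := aP _ (yA _ jn); have [r' mr'] := aC m' mn'.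
    have [zk ak] := aC k kn; have [zl al] := aC l ln.
    have [h1 h2] : commute (a 0) y /\ commute c y.
      apply: (@coset_involution_pair (a 0) c y z _ r r' (zk + zl)%R c1 xc erefl).
      - by rewrite -ajz yj.
      - by rewrite -ajz1 yj'.
      by rewrite yy ak al expgzD commute_mulA3 //; apply: commute_expgz.
    move=> t tn; have [zt ->] := aC t tn.
    by apply/commute_sym/commuteM; [|apply: commute_expgz]; apply: commute_sym.
  have e3 : n = 3 by lia.
  have A3 : A =i [:: a 0; a 1%N; a 2].
    move=> b; rewrite !inE; apply/idP/idP; last first.
      by case/or3P => /eqP ->; apply: aA; rewrite e3.
    by case/aP => -[|[|[|j]]]; rewrite ?e3 // => _ ->; rewrite eqxx ?orbT.
  have neq j j' : (j < j')%N -> (j' < n)%N -> a j != a j'.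
    by move=> jj' jn; rewrite lt_eqF ?a_lt.
  have h : {in [:: a 0; a 1%N; a 2], forall x, x ^ y = x}.
    apply: (@involution_fixes3 _ _ _ (a k) (a l)) => //; rewrite ?neq ?e3 //;
      try by apply: a_comm; rewrite e3.
    - by move=> b; rewrite -!A3 => /aP[j jn ->]; apply: yA.
    - by rewrite -A3 aA.
    - by rewrite -A3 aA.
  by move=> j jn; apply/commute_conj/h; rewrite -A3 aA.
have [|j jn|g [g1 xg ag]] := progression_of_good a_comm a_lt; first by lia.
  by move/hasPn: good => /(_ j); apply; rewrite mem_iota; lia.
have noncomm' : ~ (commute (a 0) y /\ commute g y).
  case=> h1 h2; apply: noncomm => j jn; rewrite ag //.
  by apply/commute_sym/commuteM; [|apply: commuteX]; apply: commute_sym.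
have A_def : A = [fset a 0 * g ^+ i | i in iota 0 n].
  apply/fsetP => b; apply/idP/imfsetP => /=.
    by case/aP => i i_n ->; exists i; rewrite ?mem_iota -?ag.
  by case=> i; rewrite mem_iota add0n => /= i_n ->; rewrite -ag // aA.
exists (a 0), g; split=> //.
have inA j : (j < n)%N -> a j ^ y \in A ->
    exists2 r, (r < n)%N & (a 0 * g ^+ j) ^ y = a 0 * g ^+ r.
  by move=> jn /aP[r rn e]; exists r => //; rewrite -!ag.
have [N0|[b bN]] := fset_0Vmem N.
  have gy j : (j < n)%N -> exists2 r, (r < n)%N & (a 0 * g ^+ j) ^ y = a 0 * g ^+ r.
    by move=> jn; apply: inA => //; apply/negPn; rewrite -inN ?aA // N0.
  by case: (progression_normal_form n2 xg g1 gy); [|left].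
(* The square of [A] takes at least [2n-1] of the bound, so a nonempty [N] is the singleton of [b]
   and [y * y] adds nothing new. *)
have N1 : #|` N| = (1 + #|` N `\ b|)%N by rewrite (cardfsD1 b) bN.
have yyA : y * y \in fset_square A by apply/negPn/negP => /card_sq; lia.
have Nb : N `\ b = fset0 by apply/cardfs0_eq; lia.
have [k [l [kn ln yy]]] := squareP yyA.
have [m mn bm] : exists2 m, (m < n)%N & b = a m by apply: aP; move: bN; rewrite !inE => /andP[].
have yyg : y * y = a 0 * a 0 * g ^+ (k + l).
  by rewrite yy (ag k) // (ag l) // commute_mulA3 ?expgnDr //; apply: commuteX.
have gy j : (j < n)%N -> j != m ->
    exists2 r, (r < n)%N & (a 0 * g ^+ j) ^ y = a 0 * g ^+ r.
  move=> jn jm; apply: inA => //; apply/negPn; rewrite -inN ?aA //.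
  apply/negP => jN; have : a j \in N `\ b.
    rewrite in_fsetD1 jN bm andbT.
    by case: (ltngtP j m) jm => // h _; [rewrite lt_eqF|rewrite gt_eqF]; rewrite ?a_lt.
  by rewrite Nb.
have gm r : (r < n)%N -> (a 0 * g ^+ m) ^ y != a 0 * g ^+ r.
  move=> rn; apply: contraTneq bN => e.
  by rewrite bm inN ?aA // negbK ag // e -ag // aA.
by case: (nearly_preserved_progression n2 xg g1 yyg mn gy gm); [|right].
Qed.

End RightOrdered.

Lemma abelian_generated_commute (G : groupType) (S : {fset G}) :
  {in S &, forall x z, commute x z} -> abelian_generated S.
Proof.
move=> Sc x z; elim=> {x} [x xS||x x' _ cx _ cx'|x _ cx] zS.
- elim: zS => {z} [z zS||z z' _ cz _ cz'|z _ cz].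
  + exact: Sc.
  + exact: commute1.
  + exact: commuteM.
  + exact: commuteV.
- exact/commute_sym/commute1.
- by apply/commute_sym/commuteM; apply: commute_sym; [apply: cx|apply: cx'].
- by apply/commute_sym/commuteV/commute_sym/cx.
Qed.

Theorem theorem2p9 (d : Order.disp_t) (G : rightOrderedGroupType d)
    (A : {fset G}) (y : G) (S : {fset G}) (k : nat)
    (A_nonempty : A != fset0) (A_abelian : abelian_generated A)
    (A_card : (3 <= #|` A|)%N)
    (yA : y \notin A) (S_def : S = A `|` [fset y]) (k_def : k = #|` S|)
    (S2_card : #|` fset_square S| = (3 * #|` S| - 3)%N) :
  abelian_generated S \/
  exists x g : G,
    S = [fset x * g ^+ i | i in iota 0 (k - 1)] `|` [fset y] /\
    ((forall i : nat, (i <= k - 2)%N ->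
        [~ x * g ^+ i, y] = expgz g (k%:Z - 2 - 2 * i%:Z)%R) \/
     ([~ x, y] = 1 /\ [~ y, g ^+ 2] = 1 /\ #|` S| = 4)).
Proof.
have Ac : {in A &, forall a b, commute a b}.
  by move=> a b aA bA; apply: A_abelian; apply: generated_in.
have [/allP yc|/allPn[x0 x0A x0y]] := boolP (all (fun a => [~ a, y] == 1) A).
  left; apply: abelian_generated_commute => a b; rewrite S_def !inE.
  move=> /orP[aA|/eqP ->] /orP[bA|/eqP ->] //; first exact: Ac.
  - exact/commgP/yc.
  - exact/commute_sym/commgP/yc.
right; have {}x0y : ~ commute x0 y by move/commgP; apply/negP.
have S_card : #|` S| = #|` A|.+1 by rewrite S_def fsetUC cardfsU1 yA.
(* With [n] the size of [A], the square of [S] has [3(n+1)-3 = 3n] elements; removing the [n] of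
   [yA] leaves the bound [2n]. *)
have := card_square_setU1 Ac x0A x0y; rewrite -S_def S2_card S_card => card_le.
have [|x [g [A_def xg]]] := abelian_set_normal_form Ac A_card x0A x0y; first by lia.
exists x, g; rewrite k_def S_card subn1 /= -A_def; split=> //.
case: xg => [xg|[n3 xy yg]]; [left|right].
  move: A_card xg => {A_def}; move: #|` A| => n n3 xg i i_k.
  rewrite xg; last by lia.
  by congr expgz; lia.
by rewrite n3; split; [|split] => //; apply/eqP/commgP.
Qed.
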